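(* Let $A$ be a commutative $\mathbb Q$-algebra, let $f\in A$ be a nonzerodivisor and let $B=A_f$. Let $\mathcal C$ be the category of pairs described in the context. Then $\mathcal C$ is the category of pairs $(N,M)$ consisting of a $\mathbb Z$-graded $B$-module $N=\bigoplus_{i\in\mathbb Z}N_i$ and an $A$-submodule $M$ of $N$ such that the natural map $B\otimes_A M\to N$ is an isomorphism and such that $CM\subset M$, where $C$ is the endomorphism of the graded module $N$ given by multiplication by $fi$ on $N_i$ (morphisms $(N,M)\to(N',M')$ being homomorphisms $\phi:N\to N'$ of graded $B$-modules with $\phi M\subset M'$). In other words, for a pair $(N,M)$ with $B\otimes_A M\to N$ an isomorphism, $C_nM\subset M$ for all $n\ge 0$ if and only if $CM\subset M$.
   Context: $B:=A_f$ is the localization of $A$ at $\{f^n:n\ge 0\}$; $A$ is identified with a subring of $B$. For a $\mathbb Z$-graded $B$-module $N=\bigoplus_{i\in\mathbb Z}N_i$ and $n\ge 0$, $C_n:N\to N$ is the graded $B$-linear endomorphism acting on $N_i$ as multiplication by $f^n\binom{i}{n}$, where $\binom{i}{n}=i(i-1)\cdots(i-n+1)/n!$ for all $i\in\mathbb Z$ (and $\binom{i}{0}=1$). $\mathcal C$ is the category whose objects are pairs $(N,M)$, where $N$ is a $\mathbb Z$-graded $B$-module and $M$ is an $A$-submodule of $N$ such that the natural map $B\otimes_A M\to N$ is an isomorphism and $C_nM\subset M$ for all $n\ge 0$. A morphism $(N,M)\to(N',M')$ is a homomorphism $\phi:N\to N'$ of graded $B$-modules with $\phi M\subset M'$. 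*)

(* Defs.v *)
From HB Require Import structures.
From mathcomp Require Import all_boot all_order all_algebra.
From mathcomp Require Import boolp classical_sets functions cardinality fsbigop.
From mathcomp Require Import freeg.

Set Implicit Arguments.
Unset Strict Implicit.
Unset Printing Implicit Defensive.

Import GRing.Theory.
Local Open Scope classical_set_scope.
Local Open Scope ring_scope.
Local Open Scope quotient_scope.

Definition nonzerodivisor (A : comPzRingType) (f : A) : Prop :=
  forall a : A, f * a = 0 -> a = 0.

(* iota : A -> B exhibits B as the localization A_f: every element of B is a
   fraction a / f ^ n, and a / 1 = 0 exactly when some f ^ n kills a. *)
Record is_localization (A B : comPzRingType) (f : A)
    (iota : {rmorphism A -> B}) : Prop := IsLocalization {
  loc_inv : exists g : B, iota f * g = 1;
  loc_frac : forall b : B, exists (a : A) (n : nat), iota f ^+ n * b = iota a;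
  loc_ker : forall a : A, iota a = 0 -> exists n : nat, f ^+ n * a = 0 }.

(* The B-module N regarded as an A-module along iota. *)
Definition restr (A B : comPzRingType) (iota : {rmorphism A -> B})
  (N : lmodType B) : Type := N.

Section Restr.
Variables (A B : comPzRingType) (iota : {rmorphism A -> B}) (N : lmodType B).

HB.instance Definition _ := GRing.Zmodule.on (restr iota N).

Definition restr_scale (a : A) (x : restr iota N) : restr iota N :=
  iota a *: (x : N).

Fact restr_scaleA a b x :
  restr_scale a (restr_scale b x) = restr_scale (a * b) x.
Proof. by rewrite /restr_scale scalerA rmorphM. Qed.

Fact restr_scale1 : left_id 1 restr_scale.
Proof. by move=> x; rewrite /restr_scale rmorph1 scale1r. Qed.

Fact restr_scaleDr : right_distributive restr_scale +%R.
Proof. by move=> a x y; rewrite /restr_scale scalerDr. Qed.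

Fact restr_scaleDl x : {morph restr_scale^~ x : a b / a + b}.
Proof. by move=> a b; rewrite /restr_scale rmorphD scalerDl. Qed.

HB.instance Definition _ := GRing.Zmodule_isLmodule.Build A (restr iota N)
  restr_scaleA restr_scale1 restr_scaleDr restr_scaleDl.

End Restr.

(* The module underlying a submodule. *)
Definition submod_sort (A : pzRingType) (V : lmodType A) (M : submodClosed V) :
  Type := {x : V | x \in M}.

Section Submod.
Variables (A : pzRingType) (V : lmodType A) (M : submodClosed V).
HB.instance Definition _ := [isSub of submod_sort M for @sval _ _].
HB.instance Definition _ := [Choice of submod_sort M by <:].
HB.instance Definition _ := [SubChoice_isSubLmodule of submod_sort M by <:].
End Submod.

Section Tensor.
Variables (A : comPzRingType) (U V : lmodType A).

(* The subgroup of Z[U x V] generated by the relations of the tensor product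
   over A. *)
Inductive tensor_rel : {freeg (U * V)%type / int} -> Prop :=
| Tensor0 : tensor_rel 0
| TensorB x y : tensor_rel x -> tensor_rel y -> tensor_rel (x - y)
| TensorDl u1 u2 v :
    tensor_rel (<<(u1 + u2, v)>> - (<<(u1, v)>> + <<(u2, v)>>))
| TensorDr u v1 v2 :
    tensor_rel (<<(u, v1 + v2)>> - (<<(u, v1)>> + <<(u, v2)>>))
| TensorZ a u v : tensor_rel (<<(a *: u, v)>> - <<(u, a *: v)>>).

Definition tensor_eq (x y : {freeg (U * V)%type / int}) : bool :=
  `[< tensor_rel (x - y) >].

Fact tensor_eq_refl : reflexive tensor_eq.
Proof. by move=> x; apply/asboolP; rewrite subrr; exact: Tensor0. Qed.

Fact tensor_rel_sym x y : tensor_rel (x - y) -> tensor_rel (y - x).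
Proof. by move=> h; rewrite -opprB -[- _]add0r; apply: TensorB h; exact: Tensor0. Qed.

Fact tensor_eq_sym : symmetric tensor_eq.
Proof.
by move=> x y; apply/asboolP/asboolP; exact: tensor_rel_sym.
Qed.

Fact tensor_eq_trans : transitive tensor_eq.
Proof.
move=> y x z /asboolP xy /asboolP /tensor_rel_sym zy; apply/asboolP.
by have := TensorB xy zy; rewrite opprB addrA subrK.
Qed.

Canonical tensor_equiv :=
  EquivRel tensor_eq tensor_eq_refl tensor_eq_sym tensor_eq_trans.

Definition tensor : Type := {eq_quot tensor_equiv}.
HB.instance Definition _ := Choice.on tensor.
HB.instance Definition _ := EqQuotient.on tensor.

Definition tens (u : U) (v : V) : tensor := \pi_tensor <<(u, v)>>.

End Tensor.

Section NaturalMap.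
Variables (A B : comPzRingType) (iota : {rmorphism A -> B}) (N : lmodType B).
Variable M : submodClosed (restr iota N).

Definition base_change : Type := tensor (restr iota B^o) (submod_sort M).

Definition scale_map (b : restr iota B^o) (m : submod_sort M) : N :=
  (b : B) *: (val m : N).

Fact scale_mapDl b1 b2 m :
  scale_map (b1 + b2) m = scale_map b1 m + scale_map b2 m.
Proof. exact: (scalerDl (val m : N) (b1 : B) (b2 : B)). Qed.

Fact scale_mapDr b m1 m2 :
  scale_map b (m1 + m2) = scale_map b m1 + scale_map b m2.
Proof. exact: (scalerDr (b : B) (val m1 : N) (val m2 : N)). Qed.

Fact scale_mapZ a b m : scale_map (a *: b) m = scale_map b (a *: m).
Proof.
have -> : scale_map b (a *: m) = (b : B) *: (iota a *: (val m : N)) by [].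
have -> : scale_map (a *: b) m = (iota a * (b : B)) *: (val m : N) by [].
by rewrite scalerA mulrC.
Qed.

(* zmodule N is N regarded as a module over the integers. *)
Definition natural_free :
    {freeg (restr iota B^o * submod_sort M)%type / int} -> zmodule N :=
  fglift (fun z => scale_map z.1 z.2 : zmodule N).

(* The map B (x)_A M -> N sending b (x) m to b m; it is B-linear, hence an
   isomorphism of B-modules exactly when it is bijective. *)
Definition natural_map (t : base_change) : N := natural_free (repr t).

Fact natural_freeB x y :
  natural_free (x - y) = natural_free x - natural_free y.
Proof. exact: lift_is_additive. Qed.

Fact natural_freeD x y :
  natural_free (x + y) = natural_free x + natural_free y.
Proof.
have free0 : natural_free 0 = 0 by rewrite -(subrr 0) natural_freeB subrr.
rewrite -[y in LHS]opprK natural_freeB -[- y]add0r natural_freeB free0 sub0r.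
by rewrite opprK.
Qed.

Fact natural_freeU b m : natural_free <<(b, m)>> = scale_map b m.
Proof. by rewrite /natural_free liftU scale1r. Qed.

Fact natural_free_rel x : tensor_rel x -> natural_free x = 0.
Proof.
elim=> [|y z _ hy _ hz|u1 u2 v|u v1 v2|a u v].
- by rewrite -(subrr 0) natural_freeB subrr.
- by rewrite natural_freeB hy hz; exact: subrr.
- rewrite natural_freeB natural_freeD !natural_freeU scale_mapDl.
  exact: subrr.
- rewrite natural_freeB natural_freeD !natural_freeU scale_mapDr.
  exact: subrr.
- rewrite natural_freeB !natural_freeU scale_mapZ.
  exact: subrr.
Qed.

Lemma natural_map_pi x : natural_map (\pi_base_change x) = natural_free x.
Proof.
apply/eqP; rewrite -subr_eq0 -natural_freeB; apply/eqP/natural_free_rel.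
apply/asboolP; rewrite -[`[< _ >]]/(tensor_equiv _ _ _ _).
by apply/eqquotP; exact: (reprK (\pi_(tensor _ _) x)).
Qed.

Lemma natural_map_tens b m : natural_map (tens b m) = scale_map b m.
Proof. by rewrite natural_map_pi natural_freeU. Qed.

End NaturalMap.

Definition is_submodule (B : pzRingType) (N : lmodType B) (S : set N) : Prop :=
  [/\ S 0, forall x y, S x -> S y -> S (x + y) & forall b x, S x -> S (b *: x)].

(* c is a decomposition of x along the family of subsets S. *)
Definition decomposes (B : pzRingType) (N : lmodType B) (S : int -> set N)
    (x : N) (c : int -> N) : Prop :=
  [/\ finite_set [set i | c i <> 0], forall i, S i (c i)
    & x = \sum_(i \in [set: int]) c i].

Record graded_module (B : pzRingType) := GradedModule {
  gr_mod :> lmodType B;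
  gr_part : int -> set gr_mod;
  gr_part_submod : forall i, is_submodule (gr_part i);
  gr_direct : forall x : gr_mod, exists! c, decomposes gr_part x c }.

(* The homogeneous component of degree i of x. *)
Definition gr_comp (B : pzRingType) (N : graded_module B) (i : int) (x : N) :
  N := projT1 (cid (gr_direct x)) i.

(* The graded endomorphism of N acting on N_i as multiplication by c i. *)
Definition gr_diag (B : pzRingType) (N : graded_module B) (c : int -> B)
  (x : N) : N := \sum_(i \in [set: int]) c i *: gr_comp i x.

Lemma gr_diag_hom (B : pzRingType) (N : graded_module B) (c : int -> B) i
    (x : N) :
  gr_part i x -> gr_diag c x = c i *: x.
Proof.
have sum1 (y : N) : \sum_(j \in [set: int]) (if j == i then y else 0) = y.
  rewrite -(fsbig_widen [set i]) ?fsbig_set1 ?eqxx // => j [_ /= /eqP /negPf ->].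
  by [].
move=> xi; rewrite /gr_diag /gr_comp; case: cid => d [dec uniq_d] /=.
have -> : d = fun j => if j == i then x else 0.
  apply: uniq_d; split; last by rewrite sum1.
    apply: (sub_finite_set _ (finite_set1 i)) => j /=.
    by case: eqVneq.
  move=> j; case: eqVneq => [->//|_].
  by have [] := gr_part_submod N j.
rewrite -[RHS]sum1; apply: eq_fsbigr => j _.
by case: eqVneq => [->|_] //; rewrite scaler0.
Qed.

(* Binomial coefficient with an arbitrary integer on top; the integer division
   is exact, see binzE. *)
Definition binz (i : int) (n : nat) : int :=
  ((\prod_(k < n) (i - k%:Z)) %/ n`!%:Z)%Z.

Lemma binzE i n : binz i n * n`!%:Z = \prod_(k < n) (i - k%:Z).
Proof.
apply: divzK; case: i => m.
  suff -> : \prod_(k < n) (m%:Z - k%:Z) = (m ^_ n)%:Z.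
    by rewrite -bin_ffact PoszM dvdz_mull.
  elim: n => [|n IHn]; first by rewrite big_ord0.
  rewrite big_ord_recr /= IHn ffactnSr PoszM.
  case: (leqP n m) => [le_nm|lt_mn]; first by rewrite -subzn.
  by rewrite ffact_small ?mul0r.
suff -> : \prod_(k < n) (Negz m - k%:Z) = (-1) ^+ n * ((m + n) ^_ n)%:Z.
  by rewrite -bin_ffact PoszM mulrA dvdz_mull.
elim: n => [|n IHn]; first by rewrite big_ord0 addn0 ffactn0.
rewrite big_ord_recr /= IHn addnS ffactnS /= PoszM NegzE exprS mulN1r !mulNr.
by rewrite -mulrA -mulrN; congr (_ * _); rewrite mulrC -mulNr -opprD -PoszD.
Qed.

Section Pairs.
Variables (A B : comPzRingType) (f : A) (iota : {rmorphism A -> B}).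

(* C_n: multiplication by f ^ n * binomial(i, n) on N_i. *)
Definition Cop (N : graded_module B) (n : nat) : N -> N :=
  gr_diag (fun i => iota f ^+ n * (binz i n)%:~R).

(* C: multiplication by f * i on N_i. *)
Definition Cone (N : graded_module B) : N -> N :=
  gr_diag (fun i => iota f * i%:~R).

Record module_pair := ModulePair {
  mp_mod : graded_module B;
  mp_sub : submodClosed (restr iota mp_mod) }.

Definition stable_under (X : module_pair) (T : mp_mod X -> mp_mod X) : Prop :=
  forall m : mp_mod X, m \in mp_sub X -> T m \in mp_sub X.

(* B (x)_A M -> N is an isomorphism. *)
Definition base_change_iso (X : module_pair) : Prop :=
  bijective (@natural_map A B iota (mp_mod X) (mp_sub X)).

Definition pair_hom (X Y : module_pair) : Type :=
  {phi : mp_mod X -> mp_mod Y |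
    [/\ linear phi,
        forall i x, gr_part i x -> gr_part i (phi x)
      & forall m, m \in mp_sub X -> phi m \in mp_sub Y]}.

Fact pair_id_subproof (X : module_pair) :
  [/\ linear (fun x : mp_mod X => x),
      forall i (x : mp_mod X), gr_part i x -> gr_part i x
    & forall m : mp_mod X, m \in mp_sub X -> m \in mp_sub X].
Proof. by split. Qed.

Definition pair_id (X : module_pair) : pair_hom X X :=
  exist _ _ (pair_id_subproof X).

Fact pair_comp_subproof (X Y Z : module_pair)
    (psi : pair_hom Y Z) (phi : pair_hom X Y) :
  [/\ linear (fun x => sval psi (sval phi x)),
      forall i x, gr_part i x -> gr_part i (sval psi (sval phi x))
    & forall m, m \in mp_sub X -> sval psi (sval phi m) \in mp_sub Z].
Proof.
case: psi phi => [psi [psiL psig psiM]] [phi [phiL phig phiM]]; split=> /=.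
- by move=> b x y; rewrite phiL psiL.
- by move=> i x xi; apply: psig; apply: phig.
- by move=> m mM; apply: psiM; apply: phiM.
Qed.

Definition pair_comp (X Y Z : module_pair)
    (psi : pair_hom Y Z) (phi : pair_hom X Y) : pair_hom X Z :=
  exist _ _ (pair_comp_subproof psi phi).

Lemma pair_hom_ext (X Y : module_pair) (phi psi : pair_hom X Y) :
  sval phi =1 sval psi -> phi = psi.
Proof. by case: phi psi => [u ?] [v ?] /= /funext uv; exact: eq_exist. Qed.

End Pairs.

Record category := Category {
  obj : Type;
  hom : obj -> obj -> Type;
  idm : forall X, hom X X;
  catcomp : forall X Y Z, hom Y Z -> hom X Y -> hom X Z;
  catcomp_idl : forall X Y (u : hom X Y), catcomp (idm Y) u = u;
  catcomp_idr : forall X Y (u : hom X Y), catcomp u (idm X) = u;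
  catcomp_assoc : forall X Y Z T (w : hom Z T) (v : hom Y Z) (u : hom X Y),
    catcomp w (catcomp v u) = catcomp (catcomp w v) u }.

Arguments Cop {A B} f iota N n x.
Arguments Cone {A B} f iota N x.

Section PairCategory.
Variables (A B : comPzRingType) (iota : {rmorphism A -> B}).

(* The full category of pairs (N, M) satisfying P. *)
Definition pair_category (P : module_pair iota -> Prop) : category.
Proof.
apply: (@Category {X : module_pair iota | P X}
  (fun X Y => pair_hom (sval X) (sval Y)) (fun X => pair_id (sval X))
  (fun X Y Z => @pair_comp _ _ _ (sval X) (sval Y) (sval Z))).
- by move=> X Y u; apply: pair_hom_ext.
- by move=> X Y u; apply: pair_hom_ext.
- by move=> X Y Z T w v u; apply: pair_hom_ext.
Defined.

Definition catC (f : A) : category := pair_category (fun X =>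
  base_change_iso X /\ forall n, stable_under (Cop f iota (mp_mod X) n)).

Definition catC' (f : A) : category := pair_category (fun X =>
  base_change_iso X /\ stable_under (Cone f iota (mp_mod X))).

End PairCategory.

(* Main.v *)
Require Import Defs.
From mathcomp Require Import all_boot all_order all_algebra.
From mathcomp Require Import boolp classical_sets cardinality fsbigop.
From mathcomp Require Import ring.
Import GRing.Theory.
Local Open Scope ring_scope.

(** All the operators in play are diagonal for the grading, so they compose and
    combine through their eigenvalues ([gr_diag_comp], [gr_diag_lin]).  Since
    [C_1 = C], stability under all the [C_n] gives stability under [C].
    Conversely, the recurrence [(n + 1) binom(i, n + 1) = (i - n) binom(i, n)]
    reads [(n + 1) C_(n+1) = (C - n f) C_n], and [n + 1] is invertible because
    [A] contains the rationals; thus each [C_n] is a polynomial in [C] with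
    coefficients in [A] ([Cop_rec]), and preserves every [A]-submodule that [C]
    preserves.  The two categories are the full subcategories cut out by two
    equivalent conditions on pairs, hence they coincide. *)

Section Diagonal.
Context {B : comPzRingType} {N : graded_module B}.
Implicit Types (c d : int -> B) (x : N).

Lemma gr_compP x : decomposes (@gr_part _ N) x (fun i => gr_comp i x).
Proof. by rewrite /gr_comp; case: cid => e []. Qed.

Lemma gr_comp_uniq x (e : int -> N) :
  decomposes (@gr_part _ N) x e -> forall i, gr_comp i x = e i.
Proof.
by move=> dec i; rewrite /gr_comp; case: cid => e' /= [_ uniq_e']; rewrite (uniq_e' e).
Qed.

Lemma finite_gr_supp c x : finite_set [set i | c i *: gr_comp i x <> 0]%classic.
Proof.
have [fin _ _] := gr_compP x; apply: sub_finite_set fin => i /= nz x0.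
by apply: nz; rewrite x0 scaler0.
Qed.

(** The family [c i *: gr_comp i x] is itself a homogeneous decomposition of
    its sum, hence the only one. *)
Lemma gr_comp_diag c x i : gr_comp i (gr_diag c x) = c i *: gr_comp i x.
Proof.
suff dec : decomposes (@gr_part _ N) (gr_diag c x) (fun j => c j *: gr_comp j x).
  exact: (gr_comp_uniq _ _ dec).
split=> [|j|//]; first exact: finite_gr_supp.
have [_ _ scaleS] := gr_part_submod N j.
by apply: scaleS; have [_ + _] := gr_compP x; exact.
Qed.

Lemma gr_diag_comp c d x :
  gr_diag c (gr_diag d x) = gr_diag (fun i => c i * d i) x.
Proof.
by apply: eq_fsbigr => i _; rewrite gr_comp_diag scalerA.
Qed.

Lemma gr_diag_lin (a b : B) c d x :
  gr_diag (fun i => a * c i + b * d i) x = a *: gr_diag c x + b *: gr_diag d x.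
Proof.
(* All the sums are taken over the common finite support of [x]. *)
have [fin _ _] := gr_compP x.
have E e : gr_diag e x =
    \sum_(i \in [set i | gr_comp i x <> 0]%classic) e i *: gr_comp i x.
  symmetry; apply: fsbig_widen => // i [_ /= /contrapT x0].
  by rewrite /= x0 scaler0.
rewrite !E !fsbig_finite //= !scaler_sumr -big_split /=.
by apply: eq_bigr => i _; rewrite scalerDl !scalerA.
Qed.

End Diagonal.

Lemma binz1 i : binz i 1 = i.
Proof. by rewrite -[LHS]mulr1 (binzE i 1) big_ord1 subr0. Qed.

Lemma binzS i n : binz i n.+1 * n.+1%:Z = binz i n * (i - n%:Z).
Proof.
have nz : n`!%:Z != 0 by rewrite eqz_nat -lt0n fact_gt0.
apply: (mulIf nz); rewrite -mulrA -PoszM -factS binzE big_ord_recr /= -binzE.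
by rewrite mulrAC.
Qed.

Section Operators.
Context {A B : comPzRingType} (f : A) (iota : {rmorphism A -> B}).
Context (N : graded_module B).

Lemma Cop1 (x : N) : Cop f iota N 1 x = Cone f iota N x.
Proof. by apply: eq_fsbigr => i _; rewrite binz1 expr1. Qed.

(** The operator identity [C_(n+1) = (C - n f) C_n / (n + 1)], with the scalar
    [u] playing the role of [1 / (n + 1)]. *)
Lemma Cop_rec (n : nat) (u : A) (uE : u * n.+1%:R = 1) (x : N) :
  Cop f iota N n.+1 x =
    iota u *: Cone f iota N (Cop f iota N n x)
    + iota (- (u * f * n%:R)) *: Cop f iota N n x.
Proof.
rewrite /Cone /Cop gr_diag_comp -gr_diag_lin; apply: eq_fsbigr => i _.
congr (_ *: _).
have uB : iota u * n.+1%:R = 1 by rewrite -[n.+1%:R](rmorph_nat iota) -rmorphM uE rmorph1.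
have /(congr1 (fun z : int => z%:~R : B)) := binzS i n.
rewrite !rmorphM rmorphB /= -!pmulrn => binB.
rewrite rmorphN !rmorphM rmorph_nat exprS.
have -> : (binz i n.+1)%:~R = iota u * ((binz i n)%:~R * (i%:~R - n%:R)).
  by rewrite -binB mulrCA uB mulr1.
ring.
Qed.

End Operators.

Lemma stable_Cop_Cone (A : comPzRingType) (qA : {rmorphism rat -> A}) (f : A)
    (B : comPzRingType) (iota : {rmorphism A -> B}) (X : module_pair iota) :
  (forall n : nat, stable_under (Cop f iota (mp_mod X) n))
  <-> stable_under (Cone f iota (mp_mod X)).
Proof.
split=> [stC m mM|stC]; first by rewrite -Cop1; exact: stC.
elim=> [|n IHn] m mM.
  suff -> : Cop f iota (mp_mod X) 0 m = m by [].
  have [_ _ {2}->] := gr_compP m; apply: eq_fsbigr => i _.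
  by rewrite /binz big_ord0 expr0 mul1r scale1r.
pose u : A := qA n.+1%:R^-1.
have uE : u * n.+1%:R = 1.
  by rewrite -[n.+1%:R](rmorph_nat qA) -rmorphM mulVf ?rmorph1 // Num.Theory.pnatr_eq0.
rewrite (Cop_rec f iota _ _ _ uE).
have scaleM a (y : mp_mod X) : y \in mp_sub X -> iota a *: y \in mp_sub X.
  exact: (@rpredZ _ _ (mp_sub X) a y).
apply: (@rpredD _ (mp_sub X)); apply: scaleM; last exact: IHn.
by apply: stC; exact: IHn.
Qed.

Theorem mainTheorem3 (A : comPzRingType) (qA : {rmorphism rat -> A})
    (f : A) (f_nzd : nonzerodivisor f)
    (B : comPzRingType) (iota : {rmorphism A -> B})
    (B_loc : is_localization f iota) :
  catC iota f = catC' iota f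
  /\ forall X : module_pair iota, base_change_iso X ->
       ((forall n : nat, stable_under (Cop f iota (mp_mod X) n))
        <-> stable_under (Cone f iota (mp_mod X))).
Proof.
split; last by move=> X _; exact: stable_Cop_Cone.
rewrite /catC /catC'; congr pair_category; apply/funext => X; apply/propext.
by split=> -[isoX /(stable_Cop_Cone _ qA)].
Qed.
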